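(* Let $p>1$ be real, let $A\in\mathbb{C}^{n\times n}$, and let $Q\in\mathbb{C}^{n\times n}$ be Hermitian positive definite. Put $\overline{\kappa}=\lambda_{\max}(A^*A)$ and $\underline{\kappa}=\lambda_{\min}(A^*A)$. If $$\left((p\overline{\kappa})^{\frac{1}{p+1}}-\lambda_{\min}(Q)\right)\left(\lambda_{\max}(Q)+\frac{\overline{\kappa}}{(p\overline{\kappa})^{\frac{p}{p+1}}}\right)^{p}<\underline{\kappa}\leq\overline{\kappa}<\frac{\lambda_{\max}(Q)\left(\lambda_{\min}(Q)\,p\right)^{p}}{(p-1)^{p+1}},$$ then the matrix equation $X-A^*X^{-p}A=Q$ has a unique Hermitian positive definite solution $X$.
   Context: $\lambda_{\max}(M)$ and $\lambda_{\min}(M)$ denote the largest and smallest eigenvalues of a Hermitian matrix $M$. $A^*$ is the conjugate transpose of $A$. For Hermitian positive definite $X$, $X^{-p}$ is defined by the spectral functional calculus. *)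

(* Defs.v *)
From mathcomp Require Import all_boot all_order all_algebra.
From mathcomp Require Import all_classical all_reals all_analysis.
From mathcomp Require Import complex.
Set Implicit Arguments.
Unset Strict Implicit.
Unset Printing Implicit Defensive.
Import Order.TTheory GRing.Theory Num.Theory.

Local Open Scope classical_set_scope.
Local Open Scope ring_scope.
Local Open Scope complex_scope.
Local Open Scope sesquilinear_scope.

(* [0 < z] in R[i] means that z is real and positive. *)
Definition posdefmx (R : realType) (n : nat) (X : 'M[R[i]]_n) : Prop :=
  X \is hermsymmx /\
  forall v : 'cV[R[i]]_n, v != 0 -> 0 < (v^t* *m X *m v) ord0 ord0.

Definition real_eigenvalues (R : realType) (n : nat) (M : 'M[R[i]]_n) : set R :=
  [set x : R | eigenvalue M x%:C].

(* For Hermitian M of size n > 0 these bounds are attained: see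
   [lambda_max_eigenvalue] and [lambda_min_eigenvalue] below. *)
Definition lambda_max (R : realType) (n : nat) (M : 'M[R[i]]_n) : R :=
  sup (real_eigenvalues M).

Definition lambda_min (R : realType) (n : nat) (M : 'M[R[i]]_n) : R :=
  inf (real_eigenvalues M).

(* f(M) for Hermitian M, computed in the spectral decomposition of M chosen by
   the library; [mxfun_spectral] shows that any other one gives the same
   matrix. *)
Definition mxfun (R : realType) (n : nat) (f : R -> R) (M : 'M[R[i]]_n) :
    'M[R[i]]_n :=
  invmx (spectralmx M)
    *m diag_mx (map_mx (fun z : R[i] => (f (complex.Re z))%:C) (spectral_diag M))
    *m spectralmx M.

Definition mxpowR (R : realType) (n : nat) (M : 'M[R[i]]_n) (a : R) :
    'M[R[i]]_n :=
  mxfun (fun x : R => x `^ a) M.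

Lemma mxfun_spectral (R : realType) (n : nat) (f : R -> R)
    (U : 'M[R[i]]_n) (d : 'rV[R]_n) :
  U \is unitarymx ->
  mxfun f (invmx U *m diag_mx (map_mx (fun x : R => x%:C) d) *m U) =
  invmx U *m diag_mx (map_mx (fun x : R => (f x)%:C) d) *m U.
Proof.
move=> Uu; set M := invmx U *m _ *m U.
have uU : U \in unitmx by exact: unitarymx_unit.
have Mh : M \is hermsymmx.
  apply/is_hermitianmxP; rewrite expr0 scale1r /M invmx_unitary //.
  rewrite !trmx_mul !map_mxM map_trmx trmxK -map_mx_comp.
  rewrite tr_diag_mx map_diag_mx (map_mx_id (@conjCK _)) -mulmxA.
  congr (_ *m (diag_mx _ *m _)); apply/rowP => j; rewrite !mxE.
  by apply/esym/CrealP; rewrite complex_real.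
have /hermitian_normalmx/orthomx_spectralP := Mh.
rewrite /mxfun; set S := spectralmx M; set s := spectral_diag M => ME.
have uS : S \in unitmx by exact: spectral_unit.
pose W := S *m invmx U.
have WE : diag_mx s *m W = W *m diag_mx (map_mx (fun x : R => x%:C) d).
  rewrite /W; have := ME; rewrite {1}/M => /(congr1 (mulmx S)).
  rewrite -[invmx S *m _ *m S]mulmxA mulKVmx // => /(congr1 (mulmx^~ (invmx U))).
  by rewrite !mulmxA mulmxK.
have WfE : diag_mx (map_mx (fun z : R[i] => (f (complex.Re z))%:C) s) *m W =
    W *m diag_mx (map_mx (fun x : R => (f x)%:C) d).
  apply/matrixP => i j; have := congr1 (fun N : 'M[R[i]]_n => N i j) WE.
  rewrite !mul_diag_mx !mul_mx_diag !mxE.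
  set w := (\sum_ _ _); have [->|w0] := eqVneq w 0; first by rewrite !(mulr0, mul0r).
  by rewrite [LHS]mulrC => /(mulfI w0) ->; rewrite /= mulrC.
have -> : S = W *m U by rewrite /W mulmxKV.
have uW : W \in unitmx by rewrite unitmx_mul uS unitmx_inv.
have -> : invmx (W *m U) = invmx U *m invmx W.
  have uWU : W *m U \in unitmx by rewrite unitmx_mul uW.
  apply: (can_inj (mulKmx uWU)); rewrite mulmxV //.
  by rewrite mulmxA -[W *m U *m _]mulmxA mulmxV // mulmx1 mulmxV.
clearbody W; rewrite !mulmxA; congr (_ *m _).
by rewrite -[LHS]mulmxA WfE -[LHS]mulmxA mulKmx.
Qed.

Lemma real_eigenvaluesE (R : realType) (n : nat) (M : 'M[R[i]]_n) :
  M \is hermsymmx ->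
  real_eigenvalues M = range (fun j => complex.Re (spectral_diag M ord0 j)).
Proof.
move=> Mh; have := Mh => /hermitian_normalmx/orthomx_spectralP.
set S := spectralmx M; set s := spectral_diag M => ME.
have uS : S \in unitmx by exact: spectral_unit.
have sE j : s ord0 j = (complex.Re (s ord0 j))%:C.
  have /mxOverP/(_ ord0 j) := hermitian_spectral_diag_real Mh.
  by move/RRe_real.
have SM : S *m M = diag_mx s *m S by rewrite ME -mulmxA mulKVmx.
apply/seteqP; split=> [x /= /eigenvalueP[v vM v0]|_ [j _ <-] /=].
  pose w := v *m invmx S.
  have wE : w *m diag_mx s = x%:C *: w.
    by rewrite /w scalemxAl -vM {1}ME !mulmxA mulmxK.
  have /rV0Pn[j wj] : w != 0.
    apply: contra v0 => /eqP w0.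
    by rewrite -[v](mulmxKV uS) -/w w0 mul0mx.
  clearbody w; have /rowP/(_ j) := wE; rewrite mul_mx_diag !mxE mulrC => /(mulIf wj) sj.
  by exists j => //; rewrite sj.
apply/eigenvalueP; exists (row j S).
  by rewrite -row_mul SM row_mul row_diag_mx -scalemxAl -rowE -sE.
apply/eqP => S0; have := congr1 (mulmx^~ (invmx S)) S0.
rewrite /= mul0mx -row_mul mulmxV // => /rowP/(_ j).
by rewrite !mxE eqxx => /eqP; rewrite oner_eq0.
Qed.

Lemma lambda_max_eigenvalue (R : realType) (n : nat) (M : 'M[R[i]]_n) :
  (0 < n)%N -> M \is hermsymmx ->
  eigenvalue M (lambda_max M)%:C /\
  forall x : R, eigenvalue M x%:C -> x <= lambda_max M.
Proof.
move=> n0 /real_eigenvaluesE E; pose j0 := Ordinal n0.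
pose d j := complex.Re (spectral_diag M ord0 j).
case: (arg_maxP d (erefl : xpredT j0)) => j _ dj.
have ub : ubound (real_eigenvalues M) (d j) by rewrite E => _ [k _ <-]; exact: dj.
have Ej : real_eigenvalues M (d j) by rewrite E; exists j.
have -> : lambda_max M = d j.
  apply/le_anti/andP; split; first by apply: ge_sup => //; exists (d j).
  by apply: ub_le_sup => //; exists (d j).
by split=> // x Mx; exact: ub.
Qed.

Lemma lambda_min_eigenvalue (R : realType) (n : nat) (M : 'M[R[i]]_n) :
  (0 < n)%N -> M \is hermsymmx ->
  eigenvalue M (lambda_min M)%:C /\
  forall x : R, eigenvalue M x%:C -> lambda_min M <= x.
Proof.
move=> n0 /real_eigenvaluesE E; pose j0 := Ordinal n0.
pose d j := complex.Re (spectral_diag M ord0 j).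
case: (arg_minP d (erefl : xpredT j0)) => j _ dj.
have lb : lbound (real_eigenvalues M) (d j) by rewrite E => _ [k _ <-]; exact: dj.
have Ej : real_eigenvalues M (d j) by rewrite E; exists j.
have -> : lambda_min M = d j.
  apply/le_anti/andP; split; last by apply: lb_le_inf => //; exists (d j).
  by apply: ge_inf => //; exists (d j).
by split=> // x Mx; exact: lb.
Qed.

(* Main.v *)
(* Write K and k for the extreme eigenvalues of A*A, q and m for those of Q, and
   x0 = (pK)^(1/(p+1)). On the Hermitian matrices X >= a the map
   F(X) = Q + A* X^(-p) A is Lipschitz in the Frobenius norm with constant
   p K a^(-p-1), which is below 1 exactly when a > x0. If a is the least
   eigenvalue of a solution, then X <= m + K a^(-p), whence
   a >= q + k (m + K a^(-p))^(-p), that is h(a) >= k for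
   h(a) = (a - q) (m + K a^(-p))^p. The upper bound on K makes h nondecreasing,
   and the first hypothesis says h(x0) < k, so every solution lies in the region
   where F is contracting: this gives uniqueness. For existence, iterate F on
   a <= X <= b with b = m + K x0^(-p) and a = q + k b^(-p) > x0. *)
Require Import Defs.
From mathcomp Require Import all_boot all_order all_algebra.
From mathcomp Require Import all_classical all_reals all_analysis.
From mathcomp Require Import complex ring lra.
Import Order.TTheory GRing.Theory Num.Theory.
Import numFieldNormedType.Exports.
Local Open Scope ring_scope.
Local Open Scope sesquilinear_scope.
Set Implicit Arguments.
Unset Strict Implicit.

(** * Scalar estimates *)

Section Scalar.
Context {R : realType}.
Implicit Types a b p q m k K t x y : R.

Lemma powRN_antitone a x y : 0 <= a -> 0 < x -> x <= y -> y `^ (- a) <= x `^ (- a).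
Proof.
move=> a0 x0 xy; have y0 := lt_le_trans x0 xy.
rewrite !powRN lef_pV2 ?posrE ?powR_gt0 //.
by apply: ge0_ler_powR; rewrite ?nnegrE // ltW.
Qed.

(** Mean value theorem: the derivative [- p * z ^ (- p - 1)] is largest in absolute value at the
    left end [a] of the half-line. *)
Lemma powRN_lipschitz p a x y : 0 < p -> 0 < a -> a <= x -> a <= y ->
  `|x `^ (- p) - y `^ (- p)| <= p * a `^ (- p - 1) * `|x - y|.
Proof.
move=> p0 a0; wlog xy : x y / x <= y => [hw|] ax ay.
  by case/orP: (le_total x y) => [/hw|/hw]; last rewrite distrC [`|x - y|]distrC; exact.
have pos z : z \in `[x, y] -> 0 < z.
  by rewrite in_itv /= => /andP[xz _]; apply: lt_le_trans xz; exact: lt_le_trans ax.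
have [] := @MVT_segment R (fun z => z `^ (- p)) (fun z => - p * z `^ (- p - 1)) x y xy.
- by move=> z /subset_itv_oo_cc/pos z0; exact: is_derive1_powR.
- apply: derivable_within_continuous => z /pos z0.
  by have [] := is_derive1_powR (- p) z0.
move=> c cxy E; rewrite distrC E distrC !normrM normrN (gtr0_norm p0).
rewrite ler_wpM2r // ler_wpM2l ?(ltW p0) // ger0_norm ?powR_ge0 //.
rewrite -opprD; apply: powRN_antitone => //; first by lra.
by move: cxy; rewrite in_itv /= => /andP[xc _]; exact: le_trans xc.
Qed.

(** The convex power lies above its tangent at [t]. This is Young's inequality for [a] and
    [t ^ (r - 1)] with the conjugate exponents [r] and [r / (r - 1)]. *)
Lemma powR_tangent r a t : 1 < r -> 0 <= a -> 0 < t ->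
  t `^ r + r * t `^ (r - 1) * (a - t) <= a `^ r.
Proof.
move=> r1 a0 t0; have r0 : 0 < r by lra.
have r10 : 0 < r - 1 by lra.
have := @conjugate_powR R a (t `^ (r - 1)) r (r / (r - 1)) a0 (powR_ge0 _ _) r0.
rewrite divr_gt0 // => /(_ isT).
have -> : r^-1 + (r / (r - 1))^-1 = 1 by field; lra.
rewrite -powRrM [(r - 1) * _]mulrC divfK; last lra.
move=> /(_ erefl); have -> : t `^ r = t * t `^ (r - 1) by rewrite mulr_powRB1 // ltW.
set T := t `^ (r - 1); set Z := a `^ r => H.
have /(ler_wpM2l (ltW r0)) := H.
have -> : r * (Z / r + t * T / (r / (r - 1))) = Z + (r - 1) * t * T by field; lra.
by move=> H'; lra.
Qed.

(* The minimum over [a > 0] is at [a `^ p = K * (p - 1) / m]; it is nonnegative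
   precisely when that point is at most [p * q / (p - 1)]. *)
Lemma critical_poly_ge0 p q m K a : 1 < p -> 0 < q -> 0 < m -> 0 < K -> 0 < a ->
  K < m * (q * p) `^ p / (p - 1) `^ (p + 1) ->
  0 <= m * a `^ (p + 1) - K * (p ^+ 2 - 1) * a + p ^+ 2 * K * q.
Proof.
move=> p1 q0 m0 K0 a0 HK; have p10 : 0 < p - 1 by lra.
pose s := K * (p - 1) / m; have s0 : 0 < s by rewrite /s divr_gt0 ?mulr_gt0.
pose t := s `^ p^-1.
have t0 : 0 < t by exact: powR_gt0.
have tp : t `^ p = s by rewrite /t -powRrM mulVf ?powRr1 ?(ltW s0) //; lra.
(* The minimizer [t] satisfies [t ^ p = s]; taking p-th powers turns this claim into the upper bound
   on [K]. *)
have tle : (p - 1) * t <= q * p.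
  have p0 : 0 < p by lra.
  rewrite leNgt; apply/negP => H.
  have : (q * p) `^ p < ((p - 1) * t) `^ p.
    by apply: gt0_ltr_powR; rewrite ?nnegrE ?mulr_ge0 ?(ltW p10) ?(ltW t0) ?(ltW q0) // ltW.
  rewrite [X in _ < X]powRM ?(ltW p10) ?(ltW t0) // tp => H2.
  move: HK; rewrite ltr_pdivlMr ?powR_gt0 // powRD; last by apply/implyP => _; lra.
  rewrite powRr1 ?(ltW p10) // => HK.
  move: H2; rewrite -(ltr_pM2l m0); set P := (p - 1) `^ p in HK *.
  have -> : m * (P * s) = K * (P * (p - 1)) by rewrite /s; field; lra.
  by move=> /(lt_trans HK); rewrite ltxx.
have p11 : 1 < p + 1 by lra.
(* In the tangent at [t] the coefficient of [a] is [K * (p ^ 2 - 1)], which cancels the linear term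
   and leaves [K * p * (q * p - (p - 1) * t)]. *)
have /(ler_wpM2l (ltW m0)) := @powR_tangent (p + 1) a t p11 (ltW a0) t0.
rewrite addrK (_ : t `^ (p + 1) = t * s); last first.
  by rewrite powRD ?tp ?powRr1 ?(ltW t0) 1?mulrC //; apply/implyP => _; lra.
have -> : m * (t * s + (p + 1) * t `^ p * (a - t)) =
    K * (p - 1) * t + (p + 1) * (K * (p - 1)) * (a - t).
  by rewrite tp /s; field; lra.
move=> H; have : 0 <= K * p * (q * p - (p - 1) * t).
  by rewrite mulr_ge0 ?subr_ge0 // mulr_ge0 ?(ltW K0) //; lra.
by lra.
Qed.

(** By the mean value theorem it suffices that the derivative is nonnegative; it is a product of
    powers and the polynomial of [critical_poly_ge0]. *)
Lemma threshold_nondecreasing p q m K a b : 1 < p -> 0 < q -> 0 < m -> 0 < K ->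
  0 < a -> a <= b -> K < m * (q * p) `^ p / (p - 1) `^ (p + 1) ->
  (a - q) * (m + K * a `^ (- p)) `^ p <= (b - q) * (m + K * b `^ (- p)) `^ p.
Proof.
move=> p1 q0 m0 K0 a0 ab HK; rewrite -subr_ge0.
pose u x := m + K * x `^ (- p).
have u0 x : 0 < u x by rewrite /u ltr_wpDr // mulr_ge0 ?powR_ge0 // ltW.
pose df x := u x `^ p + (x - q) * ((p * u x `^ (p - 1)) * (K * (- p * x `^ (- p - 1)))).
pose f x := (x - q) * u x `^ p.
have dfE x : 0 < x -> is_derive x 1 f (df x).
  move=> x0; have Du : is_derive x 1 u (K * (- p * x `^ (- p - 1))).
    have := is_deriveD (is_derive_cst m x 1) (is_deriveZ K (is_derive1_powR (- p) x0)).
    by rewrite add0r.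
  have Dv : is_derive x 1 (fun x => u x `^ p)
      ((p * u x `^ (p - 1)) * (K * (- p * x `^ (- p - 1)))).
    by have := is_derive1_comp (is_derive1_powR p (u0 x)) Du.
  have Dw : is_derive x 1 (fun x => x - q) 1.
    by have := is_deriveB (is_derive_id x 1) (is_derive_cst q x 1); rewrite subr0.
  have := is_deriveM Dw Dv; rewrite /df => D; apply: is_derive_eq.
  rewrite addrC; congr (_ + _); exact: mulr1.
have pos z : z \in `[a, b] -> 0 < z.
  by rewrite in_itv /= => /andP[xz _]; apply: lt_le_trans xz.
have [] := @MVT_segment R f df a b ab.
- by move=> z /subset_itv_oo_cc/pos/dfE.
- by apply: derivable_within_continuous => z /pos/dfE[].
move=> c /pos c0 ->; rewrite mulr_ge0 ?subr_ge0 //.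
have -> : df c = u c `^ (p - 1) * c `^ (- p - 1) *
    (m * c `^ (p + 1) - K * (p ^+ 2 - 1) * c + p ^+ 2 * K * q).
  (* Expressing the powers of [c] through [c1], and [u c ^ p] through [u c ^ (p - 1)], makes the
     factorisation a ring identity. *)
  rewrite /df; set c1 := c `^ (- p - 1).
  have c1E : c `^ (- p) = c1 * c.
    by rewrite /c1 mulrC -[X in X * _]powRr1 ?(ltW c0) // -powRD ?(gt_eqF c0) ?implybT // addrC subrK.
  have c2E : c `^ (p + 1) * c1 = 1.
    by rewrite -powRD ?(gt_eqF c0) ?implybT // -opprD subrr powRr0.
  have -> : u c `^ p = (m * (c `^ (p + 1) * c1) + K * (c1 * c)) * u c `^ (p - 1).
    by rewrite c2E mulr1 -c1E mulr_powRB1 ?(ltW (u0 _)) //; lra.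
  by ring.
by rewrite !mulr_ge0 ?powR_ge0 // critical_poly_ge0.
Qed.

Lemma powR_root_mul p x : 0 < p -> 0 <= x ->
  x `^ (1 / (p + 1)) `^ (p + 1) = x.
Proof. by move=> p0 x0; rewrite -powRrM divfK ?powRr1 //; lra. Qed.

(** The last premise rearranges to [h(a) >= k]. If [a <= x0], monotonicity gives
    [h(a) <= h(x0) < k], a contradiction. The conclusion is [a > x0] in the form used for the
    contraction constant. *)
Lemma lower_bound_gt p q m k K a : 1 < p -> 0 < q -> 0 < m -> 0 <= K ->
  ((p * K) `^ (1 / (p + 1)) - q) * (m + K / (p * K) `^ (p / (p + 1))) `^ p < k ->
  K < m * (q * p) `^ p / (p - 1) `^ (p + 1) ->
  0 < a -> q + k * (m + K * a `^ (- p)) `^ (- p) <= a -> p * K < a `^ (p + 1).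
Proof.
move=> p1 q0 m0; rewrite le_eqVlt => /predU1P[<-|K0].
  by rewrite mulr0 => _ _ a0 _; exact: powR_gt0.
set x0 := (p * K) `^ _ => H1 H2 a0 Ha.
have pK0 : 0 < p * K by rewrite mulr_gt0 //; lra.
rewrite ltNge; apply/negP => aK.
have ax0 : a <= x0.
  rewrite leNgt; apply/negP => x0a; move: aK; apply/negP; rewrite -ltNge.
  rewrite -[ltLHS](@powR_root_mul p) ?(ltW pK0) //; last lra.
  by apply: gt0_ltr_powR; rewrite ?nnegrE ?powR_ge0 ?(ltW a0) //; lra.
have := @threshold_nondecreasing p q m K a x0 p1 q0 m0 K0 a0 ax0 H2.
have -> : x0 `^ (- p) = ((p * K) `^ (p / (p + 1)))^-1.
  by rewrite powRN /x0 -powRrM [1 / _ * p]mulrC mulrA mulr1.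
move=> /le_lt_trans/(_ H1); apply/negP; rewrite -leNgt.
have u0 : 0 < (m + K * a `^ (- p)) `^ p.
  by rewrite powR_gt0 // ltr_wpDr // mulr_ge0 ?powR_ge0 // ltW.
by move: Ha; rewrite powRN -ler_pdivrMr // -lerBrDl.
Qed.

(** These are the bounds that make the order interval from [a] to [b] stable under [F] and put it
    where [F] contracts. *)
Lemma invariant_bounds p q m k K : 1 < p -> 0 < q -> q <= m -> 0 <= k -> k <= K ->
  ((p * K) `^ (1 / (p + 1)) - q) * (m + K / (p * K) `^ (p / (p + 1))) `^ p < k ->
  K < m * (q * p) `^ p / (p - 1) `^ (p + 1) ->
  exists a b, [/\ 0 < a, a <= b, p * K < a `^ (p + 1),
    m + K * a `^ (- p) <= b & a <= q + k * b `^ (- p)].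
Proof.
move=> p1 q0 qm k0 kK; have m0 := lt_le_trans q0 qm.
have := le_trans k0 kK; rewrite le_eqVlt => /predU1P[K0|K0].
  move=> _ _; have {}k0 : k = 0 by lra.
  by exists q, m; rewrite k0 -K0 mulr0 !mul0r !addr0; split=> //; exact: powR_gt0.
set x0 := (p * K) `^ _ => H1 H2.
have p0 : 0 < p by lra.
have pK0 : 0 < p * K by exact: mulr_gt0.
have x00 : 0 < x0 by exact: powR_gt0.
have x0E : x0 * x0 `^ p = p * K.
  rewrite -[in X in X * _](powRr1 (ltW x00)) -powRD ?(gt_eqF x00) ?implybT //.
  by rewrite addrC powR_root_mul // ltW.
have EP : (p * K) `^ (p / (p + 1)) = x0 `^ p.
  by rewrite /x0 -powRrM [1 / _ * p]mulrC mulrA mulr1.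
rewrite EP in H1.
pose b := m + K / x0 `^ p; have b0 : 0 < b.
  by rewrite ltr_wpDr // divr_ge0 ?powR_ge0 // ltW.
pose a := q + k * b `^ (- p).
have aq : q <= a by rewrite lerDl mulr_ge0 // powR_ge0.
(* After division by [b ^ p] this is the first hypothesis. *)
have x0a : x0 < a.
  by rewrite -ltrBlDl powRN ltr_pdivlMr // powR_gt0.
have bE : b = m + x0 / p.
  have xp0 : 0 < x0 `^ p by exact: powR_gt0.
  rewrite /b; congr (_ + _); have <- : x0 * x0 `^ p / p = K by rewrite x0E; field; lra.
  by field; lra.
(* As [b = m + x0 / p], the claim means [x0 <= m * p / (p - 1)]. Its [(p + 1)]-th power follows from
   the upper bound on [K] and [q <= m]. *)
have x0b : x0 <= b.
  have p10 : 0 < p - 1 by lra.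
  suff : x0 <= m * p / (p - 1).
    rewrite bE ler_pdivlMr // => H.
    by rewrite -(ler_pM2r p0) mulrDl divfK; lra.
  rewrite leNgt; apply/negP => H.
  have : (m * p / (p - 1)) `^ (p + 1) < p * K.
    rewrite -[ltRHS](@powR_root_mul p) ?(ltW pK0) //.
    by apply: gt0_ltr_powR; rewrite ?nnegrE ?powR_ge0 ?divr_ge0 ?mulr_ge0 ?(ltW p0) ?(ltW m0) ?(ltW p10) //; lra.
  apply/negP; rewrite -leNgt.
  have := H2; rewrite -(ltr_pM2l p0) => /ltW/le_trans; apply.
  rewrite [leRHS]powRM ?mulr_ge0 ?invr_ge0 ?(ltW p0) ?(ltW m0) ?(ltW p10) //.
  rewrite -[X in _ <= _ * X `^ _]powR_inv1 ?(ltW p10) // -powRrM mulN1r powRN mulrA.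
  rewrite ler_wpM2r ?invr_ge0 ?powR_ge0 // powRD ?gt_eqF ?mulr_gt0 ?addr_gt0 //.
  rewrite powRr1 ?mulr_ge0 ?(ltW p0) ?(ltW m0) // [leLHS]mulrA [p * m]mulrC [leRHS]mulrC.
  rewrite ler_wpM2l ?mulr_ge0 ?(ltW p0) ?(ltW m0) //.
  by apply: ge0_ler_powR; rewrite ?nnegrE ?mulr_ge0 ?(ltW p0) ?(ltW m0) ?(ltW q0) // ler_wpM2r // ltW.
exists a, b; split=> //.
- exact: lt_le_trans q0 aq.
- rewrite /a {2}/b lerD // -powRN; apply: ler_pM; rewrite ?powR_ge0 //.
  by apply: powRN_antitone => //; exact: ltW.
- rewrite -[ltLHS](@powR_root_mul p) ?(ltW pK0) //.
  by apply: gt0_ltr_powR; rewrite ?nnegrE ?powR_ge0 ?(le_trans (ltW q0) aq) //; lra.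
- rewrite lerD2l -powRN ler_wpM2l ?(ltW K0) //.
  by apply: powRN_antitone => //; exact: ltW.
Qed.
End Scalar.

(** * Frobenius norm and quadratic forms *)

Section Frobenius.
Context {R : realType}.
Local Notation C := R[i].

Definition sqn (z : C) : R := complex.Re z ^+ 2 + complex.Im z ^+ 2.

Lemma sqn_ge0 z : 0 <= sqn z.
Proof. by rewrite addr_ge0 ?sqr_ge0. Qed.

Lemma sqnE z : (sqn z)%:C%C = Num.conj z * z.
Proof. by rewrite mulrC -normCK -add_Re2_Im2. Qed.

Lemma sqnN z : sqn (- z) = sqn z.
Proof. by case: z => a b; rewrite /sqn /= !sqrrN. Qed.

Lemma sqn_conj z : sqn (Num.conj z) = sqn z.
Proof. by case: z => a b; rewrite /sqn /= sqrrN. Qed.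

Lemma sqnZ (a : R) z : sqn (a%:C%C * z) = a ^+ 2 * sqn z.
Proof. by case: z => x y; rewrite /sqn /=; ring. Qed.

(** The gap is the squared modulus of [z - w]. This replaces the triangle inequality without square
    roots. *)
Lemma sqnD_le z w : sqn (z + w) <= 2 * sqn z + 2 * sqn w.
Proof.
case: z w => a b [c d]; rewrite /sqn /= -subr_ge0.
have -> : 2 * (a ^+ 2 + b ^+ 2) + 2 * (c ^+ 2 + d ^+ 2) - ((a + c) ^+ 2 + (b + d) ^+ 2)
  = (a - c) ^+ 2 + (b - d) ^+ 2 by ring.
by rewrite addr_ge0 ?sqr_ge0.
Qed.

Lemma sqn_eq0 z : sqn z = 0 -> z = 0.
Proof.
case: z => a b /eqP; rewrite /sqn /= paddr_eq0 ?sqr_ge0 // !sqrf_eq0.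
by case/andP => /eqP-> /eqP->.
Qed.

(** The square of the Frobenius norm, so Lipschitz constants for it appear squared. *)
Definition fro m n (M : 'M[C]_(m, n)) : R := \sum_i \sum_j sqn (M i j).

Lemma fro_ge0 m n (M : 'M[C]_(m, n)) : 0 <= fro M.
Proof. by apply: sumr_ge0 => i _; apply: sumr_ge0 => j _; exact: sqn_ge0. Qed.

Lemma sqn_le_fro m n (M : 'M[C]_(m, n)) i j : sqn (M i j) <= fro M.
Proof.
rewrite /fro (bigD1 i) //= (bigD1 j) //= -addrA lerDl.
by rewrite addr_ge0 ?sumr_ge0 // => k _; rewrite ?sumr_ge0 // => *; exact: sqn_ge0.
Qed.

Lemma fro_eq0 m n (M : 'M[C]_(m, n)) : fro M <= 0 -> M = 0.
Proof.
move=> M0; apply/matrixP => i j; rewrite mxE; apply: sqn_eq0.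
by apply/le_anti; rewrite sqn_ge0 (le_trans (sqn_le_fro M i j)).
Qed.

Lemma froN m n (M : 'M[C]_(m, n)) : fro (- M) = fro M.
Proof. by apply: eq_bigr => i _; apply: eq_bigr => j _; rewrite mxE sqnN. Qed.

Lemma froB m n (M N : 'M[C]_(m, n)) : fro (M - N) = fro (N - M).
Proof. by rewrite -froN opprB. Qed.

Lemma froD_le m n (M N : 'M[C]_(m, n)) : fro (M + N) <= 2 * fro M + 2 * fro N.
Proof.
rewrite /fro !mulr_sumr -big_split; apply: ler_sum => i _ /=.
rewrite !mulr_sumr -big_split; apply: ler_sum => j _ /=.
by rewrite mxE sqnD_le.
Qed.

Lemma froE m n (M : 'M[C]_(m, n)) : (fro M)%:C%C = \tr (M^t* *m M).
Proof.
rewrite /fro exchange_big rmorph_sum; apply: eq_bigr => i _; rewrite mxE rmorph_sum.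
by apply: eq_bigr => j _; rewrite !mxE -sqnE.
Qed.

Lemma trmxC_mul m n p (M : 'M[C]_(m, n)) (N : 'M[C]_(n, p)) :
  (M *m N)^t* = N^t* *m M^t*.
Proof. by rewrite trmx_mul map_mxM. Qed.

Lemma trmxCB m n (M N : 'M[C]_(m, n)) : (M - N)^t* = M^t* - N^t*.
Proof. by rewrite linearB /= map_mxB. Qed.

Lemma trmxCD m n (M N : 'M[C]_(m, n)) : (M + N)^t* = M^t* + N^t*.
Proof. by rewrite linearD /= map_mxD. Qed.

Lemma fro_trmxC m n (M : 'M[C]_(m, n)) : fro (M^t*) = fro M.
Proof.
rewrite /fro exchange_big; apply: eq_bigr => i _; apply: eq_bigr => j _.
by rewrite !mxE sqn_conj.
Qed.

Lemma fro_isometry m n p (U : 'M[C]_(p, m)) (M : 'M[C]_(m, n)) :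
  U^t* *m U = 1%:M -> fro (U *m M) = fro M.
Proof.
move=> UU; apply: complexI; rewrite !froE trmxC_mul -mulmxA [U^t* *m _]mulmxA UU.
by rewrite mul1mx.
Qed.

Lemma fro_isometryr m n p (M : 'M[C]_(m, n)) (U : 'M[C]_(n, p)) :
  U *m U^t* = 1%:M -> fro (M *m U) = fro M.
Proof.
move=> UU; rewrite -fro_trmxC trmxC_mul fro_isometry ?fro_trmxC //.
by rewrite trmxCK.
Qed.

(** The sum of the forms [v* X v] over the columns [v] of [V]. For Hermitian [X] the trace is real;
    taking the real part puts it in [R]. *)
Definition qf n m (X : 'M[C]_n) (V : 'M[C]_(n, m)) : R :=
  complex.Re (\tr (V^t* *m X *m V)).

Lemma ReD (z w : C) : complex.Re (z + w) = complex.Re z + complex.Re w.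
Proof. by case: z w => ? ? []. Qed.

Lemma qfD n m (X Y : 'M[C]_n) (V : 'M[C]_(n, m)) : qf (X + Y) V = qf X V + qf Y V.
Proof. by rewrite /qf mulmxDr mulmxDl linearD ReD. Qed.

Lemma qf_congr n m k (A : 'M[C]_(k, n)) (Z : 'M[C]_k) (V : 'M[C]_(n, m)) :
  qf (A^t* *m Z *m A) V = qf Z (A *m V).
Proof. by rewrite /qf trmxC_mul !mulmxA. Qed.

Lemma qf_gram n m k (A : 'M[C]_(k, n)) (V : 'M[C]_(n, m)) :
  qf (A^t* *m A) V = fro (A *m V).
Proof. by rewrite /qf !mulmxA -trmxC_mul -mulmxA -froE. Qed.

Lemma qf_scalar n m (a : R) (V : 'M[C]_(n, m)) : qf (a%:C%C)%:M V = a * fro V.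
Proof.
by rewrite /qf mul_mx_scalar -scalemxAl mxtraceZ -froE -rmorphM.
Qed.

Lemma fro_subZ n m (M N : 'M[C]_(n, m)) (a : R) :
  fro (M - a%:C%C *: N) = fro M - 2 * a * complex.Re (\tr (N^t* *m M)) + a ^+ 2 * fro N.
Proof.
have froE' (P : 'M[C]_(n, m)) : fro P = \sum_j \sum_i sqn (P i j).
  by rewrite /fro exchange_big.
rewrite !froE' /mxtrace.
have Re_sum (I : finType) (F : I -> C) :
    complex.Re (\sum_i F i) = \sum_i complex.Re (F i).
  exact: (big_morph (@complex.Re R) ReD (erefl _)).
rewrite Re_sum !mulr_sumr -sumrN -!big_split; apply: eq_bigr => j _ /=.
rewrite mxE Re_sum !mulr_sumr -sumrN -!big_split; apply: eq_bigr => i _ /=.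
by rewrite !mxE; case: (M i j) (N i j) => x y [z w]; rewrite /sqn /=; ring.
Qed.

(** The Loewner inequality [a I <= X], tested on blocks of columns so that it applies directly to
    matrix products. *)
Definition lbmx n (a : R) (X : 'M[C]_n) :=
  forall m (V : 'M[C]_(n, m)), a * fro V <= qf X V.

Definition ubmx n (a : R) (X : 'M[C]_n) :=
  forall m (V : 'M[C]_(n, m)), qf X V <= a * fro V.

(** An operator and its adjoint have the same norm. Expand the squared norm of [A A* Z - K Z], bound
    that of [A (A* Z)] by the hypothesis, and divide by [K]; when [K = 0], [A] vanishes. *)
Lemma fro_mul_adj_le n m k (A : 'M[C]_(k, n)) (K : R) (Z : 'M[C]_(k, m)) :
  0 <= K -> ubmx K (A^t* *m A) -> fro (A^t* *m Z) <= K * fro Z.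
Proof.
rewrite le_eqVlt => /predU1P[<-|K0] HA; last first.
  have := fro_ge0 (A *m (A^t* *m Z) - K%:C%C *: Z).
  rewrite fro_subZ [Z^t* *m _]mulmxA -[Z^t* *m A]trmxCK trmxC_mul trmxCK -froE /=.
  have := HA _ (A^t* *m Z); rewrite qf_gram => H1 H2.
  have H : 0 <= K * (K * fro Z - fro (A^t* *m Z)) by lra.
  by rewrite -subr_ge0 -(pmulr_rge0 _ K0).
have A0 : A = 0.
  by apply: fro_eq0; have := HA _ 1%:M; rewrite qf_gram mulmx1 mul0r.
rewrite A0 trmx0 map_mx0 mul0mx mul0r /fro big1 // => i _; rewrite big1 // => j _.
by rewrite mxE /sqn /= expr0n addr0.
Qed.

Lemma fro_congr_le n k (A : 'M[C]_(k, n)) (K : R) (Z : 'M[C]_k) :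
  0 <= K -> ubmx K (A^t* *m A) -> fro (A^t* *m Z *m A) <= K ^+ 2 * fro Z.
Proof.
(* The adjoint of [A* Z A] is [A* (A* Z)*], so the previous bound applies twice. *)
move=> K0 HA; rewrite -fro_trmxC trmxC_mul.
apply: le_trans (fro_mul_adj_le _ K0 HA) _.
rewrite expr2 -mulrA ler_wpM2l // fro_trmxC; exact: fro_mul_adj_le.
Qed.
End Frobenius.

(** * Spectral bounds *)

Section Spectral.
Context {R : realType}.
Local Notation C := R[i].

Definition specmx n (U : 'M[C]_n) (d : 'rV[R]_n) : 'M[C]_n :=
  invmx U *m diag_mx (map_mx (fun x : R => x%:C%C) d) *m U.

Lemma hermE n (X : 'M[C]_n) : X \is hermsymmx <-> X^t* = X.
Proof.
split=> [/is_hermitianmxP | E]; first by rewrite expr0 scale1r => {2}->.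
by apply/is_hermitianmxP; rewrite expr0 scale1r E.
Qed.

Lemma herm_specmx n (X : 'M[C]_n) : X \is hermsymmx -> exists (U : 'M[C]_n) (d : 'rV[R]_n),
  [/\ U \is unitarymx, X = specmx U d & real_eigenvalues X = range (d ord0)].
Proof.
move=> Xh; exists (spectralmx X), (map_mx (@complex.Re R) (spectral_diag X)); split.
- exact: spectral_unitarymx.
- have /orthomx_spectralP XE := hermitian_normalmx Xh.
  rewrite {1}XE /specmx.
  apply: (f_equal (fun D => invmx (spectralmx X) *m diag_mx D *m spectralmx X)).
  apply/rowP => j; rewrite !mxE.
  by have /mxOverP/(_ ord0 j)/RRe_real := hermitian_spectral_diag_real Xh.
- rewrite real_eigenvaluesE //; apply: eq_set => x.
  by apply/propext; split=> -[j _ <-]; exists j; rewrite ?mxE.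
Qed.

Lemma mxfun_specmx n (f : R -> R) (U : 'M[C]_n) (d : 'rV[R]_n) :
  U \is unitarymx -> mxfun f (specmx U d) = specmx U (map_mx f d).
Proof.
move=> Uu; rewrite /specmx (mxfun_spectral f d Uu).
apply: (f_equal (fun D => invmx U *m diag_mx D *m U)).
by apply/rowP => j; rewrite !mxE.
Qed.

Lemma unitary_adjK n (U : 'M[C]_n) : U \is unitarymx -> U^t* *m U = 1%:M.
Proof. by move=> Uu; rewrite -invmx_unitary // mulVmx ?unitarymx_unit. Qed.

Lemma specmx_herm n (U : 'M[C]_n) (d : 'rV[R]_n) : U \is unitarymx -> (specmx U d)^t* = specmx U d.
Proof.
move=> Uu; rewrite /specmx (invmx_unitary Uu) !trmxC_mul trmxCK mulmxA tr_diag_mx map_diag_mx.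
apply: (f_equal (fun D => U^t* *m diag_mx D *m U)).
apply/rowP => j; rewrite !mxE.
by apply/CrealP; rewrite complex_real.
Qed.

Lemma mxfun_herm n (f : R -> R) (X : 'M[C]_n) : X \is hermsymmx ->
  (mxfun f X)^t* = mxfun f X.
Proof.
by case/herm_specmx => U [d [Uu -> _]]; rewrite (mxfun_specmx f d Uu) (specmx_herm _ Uu).
Qed.

Lemma qf_specmx n m (U : 'M[C]_n) (d : 'rV[R]_n) (V : 'M[C]_(n, m)) : U \is unitarymx ->
  qf (specmx U d) V = \sum_i d ord0 i * \sum_j sqn ((U *m V) i j).
Proof.
move=> Uu; rewrite /specmx (invmx_unitary Uu) qf_congr; set W := U *m V.
rewrite /qf /mxtrace -mulmxA mul_diag_mx; apply: complexI.
under [in RHS]eq_bigr do rewrite mulr_sumr.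
rewrite exchange_big /=.
have -> : \sum_i ((W^t* *m (\matrix_(i, j) (map_mx (fun x : R => x%:C%C) d ord0 i * W i j))) i i)
   = (\sum_j \sum_i d ord0 i * sqn (W i j))%:C%C.
  rewrite rmorph_sum; apply: eq_bigr => j _; rewrite mxE rmorph_sum.
  by apply: eq_bigr => i _; rewrite !mxE rmorphM /= sqnE mulrCA.
by [].
Qed.

Lemma specmx_lb n (U : 'M[C]_n) (d : 'rV[R]_n) a : U \is unitarymx ->
  (forall i, a <= d ord0 i) -> lbmx a (specmx U d).
Proof.
move=> Uu ad m V; rewrite (qf_specmx _ _ Uu) -(fro_isometry V (unitary_adjK Uu)).
rewrite mulr_sumr; apply: ler_sum => i _; rewrite ler_wpM2r //.
by apply: sumr_ge0 => j _; exact: sqn_ge0.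
Qed.

Lemma specmx_ub n (U : 'M[C]_n) (d : 'rV[R]_n) a : U \is unitarymx ->
  (forall i, d ord0 i <= a) -> ubmx a (specmx U d).
Proof.
move=> Uu ad m V; rewrite (qf_specmx _ _ Uu) -(fro_isometry V (unitary_adjK Uu)).
rewrite mulr_sumr; apply: ler_sum => i _; rewrite ler_wpM2r //.
by apply: sumr_ge0 => j _; exact: sqn_ge0.
Qed.

Lemma specmx_eigenvector n (U : 'M[C]_n) (d : 'rV[R]_n) i : U \is unitarymx ->
  exists v : 'cV[C]_n, fro v = 1 /\ qf (specmx U d) v = d ord0 i.
Proof.
(* The [i]-th column of [U*] is a unit eigenvector for the [i]-th entry of [d]. *)
move=> Uu; exists (U^t* *m delta_mx i ord0); rewrite (qf_specmx _ _ Uu).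
have /unitarymxP UU := Uu.
have dE k : \sum_j sqn ((delta_mx i ord0 : 'cV[C]_n) k j) = (k == i)%:R.
  rewrite big_ord1 mxE eqxx andbT /sqn.
  by case: (k == i); rewrite /= ?expr1n ?expr0n ?addr0.
split.
  rewrite fro_isometry; last by rewrite trmxCK.
  by rewrite /fro (bigD1 i) //= dE eqxx big1 ?addr0 // => k /negPf ki; rewrite dE ki.
rewrite mulmxA UU mul1mx (bigD1 i) //= dE eqxx mulr1 big1 ?addr0 // => k /negPf ki.
by rewrite dE ki mulr0.
Qed.

Lemma lbmx_specmx n (U : 'M[C]_n) (d : 'rV[R]_n) a i : U \is unitarymx ->
  lbmx a (specmx U d) -> a <= d ord0 i.
Proof.
move=> Uu aX; have [v [v1 vd]] := specmx_eigenvector d i Uu.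
by have := aX _ v; rewrite v1 vd mulr1.
Qed.

Lemma ubmx_specmx n (U : 'M[C]_n) (d : 'rV[R]_n) a i : U \is unitarymx ->
  ubmx a (specmx U d) -> d ord0 i <= a.
Proof.
move=> Uu aX; have [v [v1 vd]] := specmx_eigenvector d i Uu.
by have := aX _ v; rewrite v1 vd mulr1.
Qed.

Lemma lambda_min_lb n (X : 'M[C]_n) : (0 < n)%N -> X \is hermsymmx ->
  lbmx (lambda_min X) X.
Proof.
move=> n0 Xh; have [_ H] := lambda_min_eigenvalue n0 Xh.
have [U [d [Uu XE E]]] := herm_specmx Xh; rewrite [X in lbmx _ X]XE.
apply: specmx_lb => // i; apply: H.
suff : real_eigenvalues X (d ord0 i) by [].
by rewrite E; exists i.
Qed.

Lemma lambda_max_ub n (X : 'M[C]_n) : (0 < n)%N -> X \is hermsymmx ->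
  ubmx (lambda_max X) X.
Proof.
move=> n0 Xh; have [_ H] := lambda_max_eigenvalue n0 Xh.
have [U [d [Uu XE E]]] := herm_specmx Xh; rewrite [X in ubmx _ X]XE.
apply: specmx_ub => // i; apply: H.
suff : real_eigenvalues X (d ord0 i) by [].
by rewrite E; exists i.
Qed.

Lemma lambda_min_attained n (X : 'M[C]_n) : (0 < n)%N -> X \is hermsymmx ->
  exists v : 'cV[C]_n, fro v = 1 /\ qf X v = lambda_min X.
Proof.
move=> n0 Xh; have [H _] := lambda_min_eigenvalue n0 Xh.
have [U [d [Uu XE E]]] := herm_specmx Xh.
have : real_eigenvalues X (lambda_min X) by [].
by rewrite E => -[i _ <-]; rewrite [X in qf X]XE; exact: specmx_eigenvector.
Qed.

Lemma posdefmx_lambda_min n (X : 'M[C]_n) : (0 < n)%N -> posdefmx X ->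
  0 < lambda_min X.
Proof.
move=> n0 [Xh Xpos]; have [v [v1 <-]] := lambda_min_attained n0 Xh.
have /Xpos : v != 0.
  apply/eqP => v0; move: v1; rewrite v0 /fro big1 => [/eqP|i _].
    by rewrite eq_sym oner_eq0.
  by rewrite big1 // => j _; rewrite mxE /sqn /= expr0n addr0.
by rewrite ltcE => /andP[_]; rewrite /qf trace_mx11.
Qed.

Lemma lbmx_posdefmx n (X : 'M[C]_n) a : X \is hermsymmx -> 0 < a -> lbmx a X ->
  posdefmx X.
Proof.
move=> Xh a0 aX; split=> // v v0; rewrite ltcE; apply/andP; split; last first.
  have := aX _ v; rewrite /qf trace_mx11; apply: lt_le_trans.
  rewrite mulr_gt0 // lt_def fro_ge0 andbT; apply: contra v0 => /eqP v0.
  by rewrite (@fro_eq0 _ _ _ v) ?v0.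
have /hermE XE := Xh.
(* Positivity in [R[i]] includes a zero imaginary part: the form equals its own conjugate. *)
have : ((v^t* *m X *m v)^t*) ord0 ord0 = (v^t* *m X *m v) ord0 ord0.
  by rewrite !trmxC_mul trmxCK XE mulmxA.
rewrite !mxE; set z := \sum_(_ < n) _; case: z => x y [] /eqP.
by rewrite /= -subr_eq0 -opprD oppr_eq0 -mulr2n mulrn_eq0.
Qed.

Lemma mxpowR_ub n (X : 'M[C]_n) a p : X \is hermsymmx -> 0 < a -> 0 <= p ->
  lbmx a X -> ubmx (a `^ (- p)) (mxpowR X (- p)).
Proof.
case/herm_specmx => U [d [Uu -> _]] a0 p0 aX; rewrite /mxpowR (mxfun_specmx _ _ Uu).
apply: specmx_ub => // i; rewrite mxE; apply: powRN_antitone => //.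
exact: lbmx_specmx aX.
Qed.

Lemma mxpowR_lb n (X : 'M[C]_n) a b p : X \is hermsymmx -> 0 < a -> 0 <= p ->
  lbmx a X -> ubmx b X -> lbmx (b `^ (- p)) (mxpowR X (- p)).
Proof.
case/herm_specmx => U [d [Uu -> _]] a0 p0 aX bX; rewrite /mxpowR (mxfun_specmx _ _ Uu).
apply: specmx_lb => // i; rewrite mxE; apply: powRN_antitone => //.
  exact: lt_le_trans (lbmx_specmx i Uu aX).
exact: ubmx_specmx bX.
Qed.

(** The norm is unitarily invariant, so it dominates every eigenvalue. *)
Lemma fro_diag n (U : 'M[C]_n) (d : 'rV[R]_n) i : U \is unitarymx ->
  d ord0 i ^+ 2 <= fro (specmx U d).
Proof.
move=> Uu; have /unitarymxP UU := Uu.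
rewrite /specmx (invmx_unitary Uu) (fro_isometryr _ UU) fro_isometry; last by rewrite trmxCK.
by apply: le_trans (sqn_le_fro _ i i); rewrite !mxE eqxx mulr1n /sqn /= expr0n addr0.
Qed.

(* Conjugating by the two eigenbases turns the difference into the matrix with
   entries [(d_i - e_j) W_ij]. *)
Lemma fro_specmxB n (U V : 'M[C]_n) (d e : 'rV[R]_n) :
  U \is unitarymx -> V \is unitarymx ->
  fro (specmx U d - specmx V e) =
  \sum_i \sum_j (d ord0 i - e ord0 j) ^+ 2 * sqn ((U *m V^t*) i j).
Proof.
move=> Uu Vu; have /unitarymxP UU := Uu; have /unitarymxP VV := Vu.
rewrite -(fro_isometry _ (unitary_adjK Uu)).
rewrite -(@fro_isometryr _ _ _ _ _ (V^t*)); last by rewrite trmxCK unitary_adjK.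
have -> : U *m (specmx U d - specmx V e) *m V^t* =
    diag_mx (map_mx (fun x : R => x%:C%C) d) *m (U *m V^t*) -
    (U *m V^t*) *m diag_mx (map_mx (fun x : R => x%:C%C) e).
  rewrite mulmxBr mulmxBl /specmx (invmx_unitary Uu) (invmx_unitary Vu).
  rewrite !mulmxA UU mul1mx.
  by rewrite -[_ *m V *m V^t*]mulmxA VV mulmx1 -mulmxA.
apply: eq_bigr => i _; apply: eq_bigr => j _.
rewrite mul_diag_mx mul_mx_diag !mxE [X in _ - X]mulrC -mulrBl -rmorphB.
by rewrite sqnZ.
Qed.

(** In [fro_specmxB] the weights depend only on the eigenbases, so both sides compare term by
    term. *)
Lemma fro_specmxB_le n (U V : 'M[C]_n) (d e d' e' : 'rV[R]_n) (L : R) :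
  U \is unitarymx -> V \is unitarymx ->
  (forall i j, `|d' ord0 i - e' ord0 j| <= L * `|d ord0 i - e ord0 j|) ->
  fro (specmx U d' - specmx V e') <= L ^+ 2 * fro (specmx U d - specmx V e).
Proof.
move=> Uu Vu H; apply: le_trans (_ : L ^+ 2 * _ <= _); last first.
  by rewrite (fro_specmxB d e Uu Vu); exact: lexx.
rewrite (fro_specmxB d' e' Uu Vu) mulr_sumr; apply: ler_sum => i _; rewrite mulr_sumr.
apply: ler_sum => j _; rewrite mulrA ler_wpM2r ?sqn_ge0 //.
rewrite -[X in X <= _]real_normK ?num_real //.
rewrite -[X in _ * X]real_normK ?num_real // -exprMn lerXn2r ?nnegrE //.
exact: le_trans (H i j).
Qed.

(** A scalar Lipschitz constant passes to matrices that may fail to commute; the lower bounds place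
    all eigenvalues where [f] is controlled. *)
Lemma fro_mxfun_lipschitz n (f : R -> R) (L a : R) (X Y : 'M[C]_n) :
  X \is hermsymmx -> Y \is hermsymmx -> lbmx a X -> lbmx a Y ->
  (forall x y, a <= x -> a <= y -> `|f x - f y| <= L * `|x - y|) ->
  fro (mxfun f X - mxfun f Y) <= L ^+ 2 * fro (X - Y).
Proof.
case/herm_specmx => U [d [Uu -> _]]; case/herm_specmx => V [e [Vu -> _]] aX aY fL.
rewrite (f_equal2 (fun M N => M - N) (mxfun_specmx f d Uu) (mxfun_specmx f e Vu)).
apply: (fro_specmxB_le Uu Vu) => i j.
have := fL _ _ (lbmx_specmx i Uu aX) (lbmx_specmx j Vu aY).
by rewrite !mxE.
Qed.

Lemma herm_closed n (X : 'M[C]_n) :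
  (forall e, 0 < e -> exists Y : 'M[C]_n, Y \is hermsymmx /\ fro (X - Y) <= e) ->
  X \is hermsymmx.
Proof.
move=> H; apply/hermE/eqP; rewrite -subr_eq0; apply/eqP; apply: fro_eq0.
apply/ler_addgt0Pr => e e0; rewrite add0r.
(* [froD_le] doubles each of two terms, hence the quarter. *)
have [Y [/hermE Yh XY]] := H (e / 4) (divr_gt0 e0 (ltr0n _ 4)).
rewrite -(subrK Y (X^t*)) -addrA; apply: le_trans (froD_le _ _) _.
by rewrite -{1}Yh -trmxCB fro_trmxC [fro (Y - X)]froB; lra.
Qed.

(** A nearby [Y] has [Y - X] with eigenvalues at most [c], so passing from [Y] to [X] lowers the
    form by at most [c * fro V <= e]. *)
Lemma lbmx_closed n (X : 'M[C]_n) a : X \is hermsymmx ->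
  (forall e, 0 < e -> exists Y : 'M[C]_n,
    [/\ Y \is hermsymmx, lbmx a Y & fro (X - Y) <= e]) -> lbmx a X.
Proof.
move=> /hermE Xh H m V; apply/ler_addgt0Pr => e e0.
(* Adding 1 keeps the denominator positive when [V = 0]. *)
pose c := e / (fro V + 1).
have V1 : 0 < fro V + 1 by rewrite ltr_wpDl ?fro_ge0.
have c0 : 0 < c by rewrite divr_gt0.
have [|Y [/hermE Yh aY XY]] := H (c ^+ 2); first by rewrite exprn_gt0.
have /herm_specmx[U [d [Uu E _]]] : Y - X \is hermsymmx.
  by apply/hermE; rewrite trmxCB Xh Yh.
have dc i : d ord0 i <= c.
  rewrite froB E in XY; have := le_trans (fro_diag d i Uu) XY.
  have [d0 _|d0] := leP (d ord0 i) 0; first exact: le_trans d0 (ltW c0).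
  by rewrite ler_sqr ?nnegrE ?(ltW d0) ?(ltW c0).
have YX : qf Y V = qf (Y - X) V + qf X V by rewrite -qfD subrK.
have H1 := specmx_ub Uu dc V; rewrite -E in H1.
have H2 : c * fro V <= e.
  by rewrite /c mulrAC ler_pdivrMr // ler_wpM2l ?(ltW e0) // lerDl ler01.
apply: le_trans (aY _ V) _; rewrite YX addrC lerD2l.
exact: le_trans H1 H2.
Qed.
End Spectral.

(** * Fixed points of contractions *)

Section FixedPoint.
Context {R : realType}.
Local Notation C := R[i].

(** The sequence is a telescoping series dominated by a geometric one. *)
Lemma cvgn_geometric_increments (u : nat -> R) (c r : R) : 0 <= c -> 0 <= r -> r < 1 ->
  (forall k, `|u k.+1 - u k| <= c * r ^+ k) -> cvgn u.
Proof.
move=> c0 r0 r1 H; have -> : u = (fun k => u 0%N + series (telescope u) k).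
  by apply/funext => k; exact: eq_sum_telescope.
apply: is_cvgD; first exact: is_cvg_cst.
apply: normed_cvg; apply: (@series_le_cvg _ _ (geometric c r)) => //.
- by move=> k; exact: normr_ge0.
- by move=> k; rewrite /= mulr_ge0 ?exprn_ge0.
- by apply: is_cvg_geometric_series; rewrite ger0_norm.
Qed.

Lemma cvg_sumr (I : finType) (F : I -> nat -> R) (l : I -> R) :
  (forall i, (F i @ \oo --> l i)%classic) ->
  ((fun k => \sum_i F i k) @ \oo --> \sum_i l i)%classic.
Proof.
move=> H; have -> : (fun k => \sum_i F i k) = \sum_i F i by rewrite fct_sumE.
apply: (big_ind2 (fun (f : nat -> R) (x : R) => (f @ \oo --> x)%classic)) => //.
- exact: cvg_cst.
- by move=> f x g y fx gy; exact: cvgD.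
Qed.

(** Real and imaginary parts of each entry have geometric increments, hence converge; [fro] of the
    error is a finite sum of squares tending to 0. *)
Lemma fro_complete m n (X : nat -> 'M[C]_(m, n)) (c r : R) :
  0 <= c -> 0 <= r -> r < 1 ->
  (forall k, fro (X k.+1 - X k) <= (c * r ^+ k) ^+ 2) ->
  exists L, ((fun k => fro (L - X k)) @ \oo --> 0)%classic.
Proof.
move=> c0 r0 r1 H.
have crk k : 0 <= c * r ^+ k by rewrite mulr_ge0 ?exprn_ge0.
have sqn_le i j k : sqn (X k.+1 i j - X k i j) <= (c * r ^+ k) ^+ 2.
  by apply: le_trans (H k); have := sqn_le_fro (X k.+1 - X k) i j; rewrite !mxE.
have le_abs (x y b : R) : 0 <= b -> x ^+ 2 + y ^+ 2 <= b ^+ 2 -> `|x| <= b /\ `|y| <= b.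
  move=> b0 xyb; split; rewrite -(@ler_sqr _ `|_|) ?nnegrE // real_normK ?num_real //.
    by apply: le_trans xyb; rewrite lerDl sqr_ge0.
  by apply: le_trans xyb; rewrite lerDr sqr_ge0.
have step i j k : `|complex.Re (X k.+1 i j) - complex.Re (X k i j)| <= c * r ^+ k /\
    `|complex.Im (X k.+1 i j) - complex.Im (X k i j)| <= c * r ^+ k.
  apply: le_abs => //; have := sqn_le i j k.
  by case: (X k.+1 i j) (X k i j) => ? ? [].
have cRe i j : cvgn (fun k => complex.Re (X k i j)).
  by apply: (cvgn_geometric_increments c0 r0 r1) => k; have [] := step i j k.
have cIm i j : cvgn (fun k => complex.Im (X k i j)).
  by apply: (cvgn_geometric_increments c0 r0 r1) => k; have [] := step i j k.
pose a i j := limn (fun k => complex.Re (X k i j)).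
pose b i j := limn (fun k => complex.Im (X k i j)).
exists (\matrix_(i, j) (a i j +i* b i j)%C).
rewrite (_ : 0 = \sum_(i < m) \sum_(j < n) 0); last first.
  by rewrite big1 // => i _; rewrite big1.
apply: cvg_sumr => i; apply: cvg_sumr => j.
rewrite (_ : (fun k => _) = (fun k => (a i j - complex.Re (X k i j)) ^+ 2 +
    (b i j - complex.Im (X k i j)) ^+ 2)); last first.
  by apply/funext => k; rewrite !mxE; case: (X k i j).
have Ha : ((fun k => a i j - complex.Re (X k i j)) @ \oo --> 0)%classic.
  by rewrite -(subrr (a i j)); apply: cvgB; [exact: cvg_cst | exact: cRe].
have Hb : ((fun k => b i j - complex.Im (X k i j)) @ \oo --> 0)%classic.
  by rewrite -(subrr (b i j)); apply: cvgB; [exact: cvg_cst | exact: cIm].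
have := cvgD (cvgM Ha Ha) (cvgM Hb Hb); rewrite mulr0 addr0; exact.
Qed.

(** Banach iteration with two regions: the iterates stay in [D], while [E] carries the contraction
    estimate and contains every limit of points of [D]. *)
Lemma contraction_fixpoint n (F : 'M[C]_n -> 'M[C]_n) (D E : 'M[C]_n -> Prop)
    (r : R) (X0 : 'M[C]_n) :
  0 <= r -> r < 1 -> D X0 -> (forall X, D X -> D (F X)) -> (forall X, D X -> E X) ->
  (forall X, (forall e, 0 < e -> exists Y, D Y /\ fro (X - Y) <= e) -> E X) ->
  (forall X Y, E X -> E Y -> fro (F X - F Y) <= r ^+ 2 * fro (X - Y)) ->
  exists X, E X /\ F X = X.
Proof.
move=> r0 r1 D0 DF DE Ecl HF; pose X k := iter k F X0.
have DX k : D (X k) by elim: k => // k; exact: DF.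
pose c := Num.sqrt (fro (X 1%N - X 0%N)).
have step k : fro (X k.+1 - X k) <= (c * r ^+ k) ^+ 2.
  elim: k => [|k IH]; first by rewrite expr0 mulr1 sqr_sqrtr ?fro_ge0.
  apply: le_trans (HF _ _ (DE _ (DX k.+1)) (DE _ (DX k))) _.
  rewrite [r ^+ k.+1]exprS mulrCA [leRHS]exprMn ler_wpM2l ?sqr_ge0 //.
have [L HL] := fro_complete (sqrtr_ge0 _) r0 r1 step.
have near e : 0 < e -> exists k, fro (L - X k) <= e /\ fro (L - X k.+1) <= e.
  move=> e0; have /cvgr_distC_le/(_ e e0)[N _ HN] := HL.
  exists N; have le_e k : (N <= k)%N -> fro (L - X k) <= e.
    by move=> /HN /=; rewrite subr0 ger0_norm ?fro_ge0.
  by split; apply: le_e.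
have EL : E L.
  by apply: Ecl => e /near[k [Hk _]]; exists (X k).
exists L; split=> //; apply/eqP; rewrite -subr_eq0; apply/eqP; apply: fro_eq0.
apply/ler_addgt0Pr => e e0; rewrite add0r.
have [k [H1 H2]] := near (e / 4) (divr_gt0 e0 (ltr0n _ 4)).
(* Split [F L - L] at [F (X k)], which is the next iterate: both pieces have [fro] at most
   [e / 4]. *)
rewrite -(subrK (F (X k)) (F L)) -addrA.
apply: le_trans (froD_le _ _) _.
have := HF _ _ EL (DE _ (DX k)); rewrite -[F (X k)]/(X k.+1) => H3.
have : r ^+ 2 * fro (L - X k) <= fro (L - X k).
  by rewrite ler_piMl ?fro_ge0 // expr_le1 // ltW.
by rewrite (froB (X k.+1)); lra.
Qed.
End FixedPoint.

(** * The matrix equation *)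

Section Equation.
Context {R : realType} {n : nat}.
Local Notation C := R[i].
Variables (p : R) (A Q : 'M[C]_n).
Hypothesis p0 : 0 < p.
Hypothesis Qh : Q \is hermsymmx.
Implicit Types X Y : 'M[C]_n.

Definition eqn_map X : 'M[C]_n := Q + A^t* *m mxpowR X (- p) *m A.

Lemma eqn_map_herm X : X \is hermsymmx -> eqn_map X \is hermsymmx.
Proof.
move=> Xh; apply/hermE; have /hermE QE := Qh.
have ZE : (mxpowR X (- p))^t* = mxpowR X (- p) := mxfun_herm _ Xh.
rewrite /eqn_map trmxCD trmxC_mul [(A^t* *m _)^t*]trmxC_mul trmxCK ZE QE.
by rewrite mulmxA.
Qed.

(** [X <= b] gives [X ^ (- p) >= b ^ (- p)], and congruence by [A] multiplies this by
    [A* A >= k]. *)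
Lemma eqn_map_lb X a b q k : X \is hermsymmx -> 0 < a -> lbmx a X -> ubmx b X ->
  lbmx q Q -> lbmx k (A^t* *m A) -> lbmx (q + k * b `^ (- p)) (eqn_map X).
Proof.
move=> Xh a0 aX bX qQ kA m V; rewrite /eqn_map qfD qf_congr mulrDl.
apply: lerD; first exact: qQ.
apply: le_trans _ (mxpowR_lb Xh a0 (ltW p0) aX bX (A *m V)).
rewrite mulrAC mulrC ler_wpM2l ?powR_ge0 //.
by have := kA _ V; rewrite qf_gram.
Qed.

Lemma eqn_map_ub X a m K : X \is hermsymmx -> 0 < a -> lbmx a X ->
  ubmx m Q -> ubmx K (A^t* *m A) -> ubmx (m + K * a `^ (- p)) (eqn_map X).
Proof.
move=> Xh a0 aX mQ KA l V; rewrite /eqn_map qfD qf_congr mulrDl.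
apply: lerD; first exact: mQ.
apply: le_trans (mxpowR_ub Xh a0 (ltW p0) aX (A *m V)) _.
rewrite [leRHS]mulrAC [leRHS]mulrC ler_wpM2l ?powR_ge0 //.
by have := KA _ V; rewrite qf_gram.
Qed.

(** [Q] cancels; congruence by [A] contributes [K] and the power contributes [p * a ^ (- p - 1)]. *)
Lemma eqn_map_lipschitz X Y a K : X \is hermsymmx -> Y \is hermsymmx -> 0 < a ->
  lbmx a X -> lbmx a Y -> 0 <= K -> ubmx K (A^t* *m A) ->
  fro (eqn_map X - eqn_map Y) <= (K * (p * a `^ (- p - 1))) ^+ 2 * fro (X - Y).
Proof.
move=> Xh Yh a0 aX aY K0 KA.
have -> : eqn_map X - eqn_map Y = A^t* *m (mxpowR X (- p) - mxpowR Y (- p)) *m A.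
  by rewrite /eqn_map opprD addrACA subrr add0r mulmxBr mulmxBl.
apply: le_trans (fro_congr_le _ K0 KA) _; rewrite [in leRHS]exprMn -[leRHS]mulrA.
rewrite ler_wpM2l ?sqr_ge0 //; apply: fro_mxfun_lipschitz Xh Yh aX aY _ => x y ax ay.
exact: powRN_lipschitz.
Qed.

Lemma contraction_factor K a : 0 < a -> p * K < a `^ (p + 1) ->
  K * (p * a `^ (- p - 1)) < 1.
Proof.
move=> a0 H; rewrite -opprD powRN mulrA ltr_pdivrMr ?powR_gt0 // mul1r.
by rewrite mulrC.
Qed.
End Equation.

Unset Implicit Arguments.
Set Strict Implicit.

Theorem theorem3p2 (R : realType) (n : nat) (p : R) (A Q : 'M[R[i]]_n) :
  1 < p ->
  posdefmx Q ->
  let kmax := lambda_max (A^t* *m A) in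
  let kmin := lambda_min (A^t* *m A) in
  ((p * kmax) `^ (1 / (p + 1)) - lambda_min Q)
      * (lambda_max Q + kmax / (p * kmax) `^ (p / (p + 1))) `^ p < kmin ->
  kmin <= kmax ->
  kmax < lambda_max Q * (lambda_min Q * p) `^ p / (p - 1) `^ (p + 1) ->
  exists! X : 'M[R[i]]_n, posdefmx X /\ X - A^t* *m mxpowR X (- p) *m A = Q.
Proof.
case: n A Q => [|n'] A Q p1 Qpos kmax kmin H1 kk H2.
  (* In size 0 all matrices coincide. *)
  exists Q; split=> [|Y _]; last by apply/matrixP => -[].
  by split=> //; apply/matrixP => -[].
have n0 : (0 < n'.+1)%N by [].
have p0 := lt_trans ltr01 p1.
have [Qh _] := Qpos.
have Ah : A^t* *m A \is hermsymmx by apply/hermE; rewrite trmxC_mul trmxCK.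
have kA := lambda_min_lb n0 Ah; have KA := lambda_max_ub n0 Ah.
have qQ := lambda_min_lb n0 Qh; have mQ := lambda_max_ub n0 Qh.
rewrite -/kmax -/kmin in kA KA.
have q0 := posdefmx_lambda_min n0 Qpos.
have qm : lambda_min Q <= lambda_max Q.
  have [v [v1 <-]] := lambda_min_attained n0 Qh.
  by have := mQ _ v; rewrite v1 mulr1.
have m0 := lt_le_trans q0 qm.
(* At a unit eigenvector [v], [kmin] is the squared norm of [A v]. *)
have k0 : 0 <= kmin.
  by have [v [v1]] := lambda_min_attained n0 Ah; rewrite -/kmin qf_gram => <-; exact: fro_ge0.
have K0 := le_trans k0 kk.
have eqnE X : X - A^t* *m mxpowR X (- p) *m A = Q <-> eqn_map p A Q X = X.
  by split=> [<-|/esym E]; rewrite /eqn_map ?subrK // {1}E /eqn_map addrK.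
have contr a X Y : 0 < a -> X \is hermsymmx -> Y \is hermsymmx ->
    lbmx a X -> lbmx a Y -> fro (eqn_map p A Q X - eqn_map p A Q Y) <=
    (kmax * (p * a `^ (- p - 1))) ^+ 2 * fro (X - Y).
  by move=> a0 Xh Yh aX aY; exact: (eqn_map_lipschitz Q p0 Xh Yh a0 aX aY K0 KA).
have r0 a : 0 <= kmax * (p * a `^ (- p - 1)).
  by rewrite !mulr_ge0 ?powR_ge0 // ltW.
(* The fixed-point equation turns the least eigenvalue into an upper bound on [X], and that into a
   new lower bound; testing it on the least eigenvector gives the premise of [lower_bound_gt]. *)
have sol_lb X : posdefmx X -> eqn_map p A Q X = X -> p * kmax < lambda_min X `^ (p + 1).
  move=> Xpos XE; have [Xh _] := Xpos; have a0 := posdefmx_lambda_min n0 Xpos.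
  have aX := lambda_min_lb n0 Xh.
  have bX := eqn_map_ub p0 Xh a0 aX mQ KA; rewrite XE in bX.
  have cX := eqn_map_lb p0 Xh a0 aX bX qQ kA; rewrite XE in cX.
  apply: (lower_bound_gt p1 q0 m0 K0 H1 H2 a0).
  have [v [v1 vX]] := lambda_min_attained n0 Xh.
  by have := cX _ v; rewrite v1 mulr1 vX.
have [a [b [a0 ab aK Hb Ha]]] := invariant_bounds p1 q0 qm k0 kk H1 H2.
(* Iterate from [a I] inside the order interval from [a] to [b]; the limit is placed in the region
   [X >= a]. *)
have [|||||X [[Xh aX] XE]] := @contraction_fixpoint R n'.+1 (eqn_map p A Q)
    (fun X => [/\ X \is hermsymmx, lbmx a X & ubmx b X])
    (fun X => X \is hermsymmx /\ lbmx a X)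
    (kmax * (p * a `^ (- p - 1))) (a%:C%C)%:M (r0 a) (contraction_factor a0 aK).
- split.
  + apply/hermE; rewrite tr_scalar_mx map_scalar_mx; congr (_%:M).
    by apply/CrealP; rewrite complex_real.
  + by move=> m V; rewrite qf_scalar; exact: lexx.
  + by move=> m V; rewrite qf_scalar; apply: ler_wpM2r ab; exact: fro_ge0.
- move=> X [Xh aX bX]; split.
  + exact: eqn_map_herm.
  + move=> m V; apply: le_trans (eqn_map_lb p0 Xh a0 aX bX qQ kA V).
    by rewrite ler_wpM2r ?fro_ge0.
  + move=> m V; apply: le_trans (eqn_map_ub p0 Xh a0 aX mQ KA V) _.
    by rewrite ler_wpM2r ?fro_ge0.
- by move=> X [].
- move=> X H.
  have Xh : X \is hermsymmx.
    by apply: herm_closed => e /H[Y [[Yh _ _] XY]]; exists Y.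
  split; first exact: Xh.
  apply: lbmx_closed Xh _ => e /H[Y [[Yh aY _] XY]].
  by exists Y.
- by move=> X Y [Xh aX] [Yh aY]; exact: (contr a X Y a0 Xh Yh aX aY).
exists X; split.
  by split; [exact: lbmx_posdefmx aX | exact/eqnE].
have Xpos : posdefmx X by exact: lbmx_posdefmx aX.
move=> Y [Ypos /eqnE YE]; have [Yh _] := Ypos.
(* The smaller least eigenvalue bounds both solutions from below and still exceeds [x0], so one
   contraction constant serves both. *)
pose c := Num.min (lambda_min X) (lambda_min Y).
have c0 : 0 < c.
  rewrite lt_min; apply/andP; split; first exact: posdefmx_lambda_min Xpos.
  exact: posdefmx_lambda_min Ypos.
have cK : p * kmax < c `^ (p + 1).
  by rewrite /c minElt; case: ifP => _; [exact: sol_lb Xpos XE | exact: sol_lb Ypos YE].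
have lb_le d (Z : 'M[R[i]]_n'.+1) : Z \is hermsymmx -> d <= lambda_min Z -> lbmx d Z.
  move=> Zh dZ m V; apply: le_trans (lambda_min_lb n0 Zh V).
  by rewrite ler_wpM2r ?fro_ge0.
have := contr c X Y c0 Xh Yh.
have [cX cY] : c <= lambda_min X /\ c <= lambda_min Y.
  by rewrite /c; move: (lambda_min X) (lambda_min Y) => x y; rewrite !ge_min !lexx orbT.
rewrite XE YE => /(_ (lb_le _ _ Xh cX) (lb_le _ _ Yh cY)) H.
apply/eqP; rewrite -subr_eq0; apply/eqP; apply: fro_eq0.
have r1 : (kmax * (p * c `^ (- p - 1))) ^+ 2 < 1.
  by rewrite expr_lt1 ?r0 ?contraction_factor.
(* A positive distance between two fixed points would be strictly shrunk by [F], which leaves it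
   unchanged. *)
rewrite leNgt; apply/negP => f0.
by move: H; rewrite -[leLHS]mul1r ler_pM2r // leNgt r1.
Qed.
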